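(* Suppose that $S$ is a separable metric space with metric $d$. For $1\le n\le\infty$, let $P_n$ be a transition kernel on $S$ that has the $\mathrm{Lip}_b(1)$ inclusion property and possesses a unique stationary distribution $\pi_n$. Assume further that for each $x\in S$: (i) $P_n(x,\cdot)\Rightarrow P_\infty(x,\cdot)$ as $n\to\infty$; (ii) $P_{\infty,x}(X_m\in\cdot)\Rightarrow\pi_\infty(\cdot)$ as $m\to\infty$; (iii) $\pi_n\Rightarrow\pi_\infty$ as $n\to\infty$. Then, for each $x\in S$, $$\sup_{m\ge 0}\| P_{n,x}(X_m\in\cdot)-P_{\infty,x}(X_m\in\cdot)\|_{\mathrm{Lip}_b(1)}\to 0\quad\text{as } n\to\infty.$$
   Context: The index $n$ ranges over $\{1,2,\dots\}\cup\{\infty\}$. $S$ carries its Borel $\sigma$-algebra and $\Rightarrow$ denotes weak convergence of probabilities on $S$. For $x\in S$, $P_{n,x}$ is the probability on path space $S^\infty$ under which the coordinate process $X=(X_m:m\ge 0)$ is a Markov chain with $X_0=x$ and one-step transition kernel $P_n$. A stationary distribution of $P_n$ is a probability $\pi_n$ with $\int_S\pi_n(dy)P_n(y,\cdot)=\pi_n(\cdot)$. For $r>0$, $\mathrm{Lip}_b(r)$ is the family of functions $f:S\to\mathbb{R}$ such that $|f(x)|\le 1$ for all $x\in S$ and $|f(x)-f(y)|\le r\,d(x,y)$ for all $x,y\in S$. For a finite signed measure $\nu$, $\|\nu\|_{\mathrm{Lip}_b(1)}=\sup_{f\in\mathrm{Lip}_b(1)}\left|\int_S f\,d\nu\right|$.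 A kernel $Q$ has the $\mathrm{Lip}_b(1)$ inclusion property if $Qf\in\mathrm{Lip}_b(1)$ whenever $f\in\mathrm{Lip}_b(1)$, where $(Qf)(x)=\int_S f(y)\,Q(x,dy)$. *)

(* Defs.v *)
From HB Require Import structures.
From mathcomp Require Import all_boot all_order all_algebra.
From mathcomp Require Import all_classical all_reals all_analysis.

Set Implicit Arguments.
Unset Strict Implicit.
Unset Printing Implicit Defensive.

Import Order.TTheory GRing.Theory Num.Theory.
Import numFieldNormedType.Exports.

Local Open Scope classical_set_scope.
Local Open Scope ring_scope.

(* In MathComp-Analysis a measurableType is pointed, hence the metric spaces
   considered are; a space carrying a probability is nonempty anyway. *)
#[short(type="pmetricType")]
HB.structure Definition PMetric (K : numDomainType) :=
  { M of Metric K M & Pointed M }.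

Notation borel S := (g_sigma_algebraType (@open S)).

Definition separable (T : topologicalType) :=
  exists2 D : set T, countable D & dense D.

Section integrals.
Context (R : realType) (S : pmetricType R).
Implicit Types (mu : {measure set (borel S) -> \bar R}) (f : S -> R).

Definition weak_cvg (mu_ : nat -> {measure set (borel S) -> \bar R}) mu :=
  forall f, continuous f -> bounded_fun f ->
    \int[mu_ n]_y f y @[n --> \oo] --> \int[mu]_y f y.

Definition Lip_b (r : R) : set (S -> R) :=
  [set f | (forall x, `|f x| <= 1) /\
           (forall x y, `|f x - f y| <= r * mdist x y)].

Definition Lip_b1_inclusion (Q : R.-pker (borel S) ~> (borel S)) :=
  forall f, Lip_b 1 f -> Lip_b 1 (fun x => \int[Q x]_y f y).

Definition hahn_pos (nu : {charge set (borel S) -> \bar R}) : set (borel S) :=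
  sval (cid (Hahn_decomposition nu)).

Definition hahn_neg (nu : {charge set (borel S) -> \bar R}) : set (borel S) :=
  sval (cid (svalP (cid (Hahn_decomposition nu)))).

Lemma hahn_pos_neg nu : hahn_decomposition nu (hahn_pos nu) (hahn_neg nu).
Proof. exact: svalP (cid (svalP (cid (Hahn_decomposition nu)))). Qed.

(* The integral against a signed measure is the difference of the integrals
   against the two parts of its Jordan decomposition; these parts do not depend
   on the Hahn decomposition chosen. *)
Definition charge_integral (nu : {charge set (borel S) -> \bar R}) f : R :=
  \int[jordan_pos (hahn_pos_neg nu)]_y f y -
  \int[jordan_neg (hahn_pos_neg nu)]_y f y.

Definition Lip_b1_norm (nu : {charge set (borel S) -> \bar R}) : \bar R :=
  ereal_sup [set (`|charge_integral nu f|)%:E | f in Lip_b 1].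

Definition charge_diff (mu1 mu2 : {finite_measure set (borel S) -> \bar R}) :
    {charge set (borel S) -> \bar R} :=
  cadd (charge_of_finite_measure mu1) (copp (charge_of_finite_measure mu2)).

Definition stationary (Q : R.-pker (borel S) ~> (borel S))
    (pi : probability (borel S) R) :=
  forall B : set (borel S), measurable B -> (\int[pi]_y Q y B)%E = pi B.

(* Probabilities are total functions on sets, so uniqueness is agreement on
   the measurable ones. *)
Definition unique_stationary (Q : R.-pker (borel S) ~> (borel S))
    (pi : probability (borel S) R) :=
  stationary Q pi /\
  forall mu : probability (borel S) R, stationary Q mu ->
    forall B : set (borel S), measurable B -> mu B = pi B.

End integrals.

Definition cylinders (R : realType) (S : pmetricType R) : set (set (nat -> S)) :=
  \bigcup_m preimage_set_system setT (fun w : nat -> borel S => w m) measurable.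

Arguments cylinders {R} S.

Notation path_space S := (g_sigma_algebraType (cylinders S)).

Section markov_chain.
Context (R : realType) (S : pmetricType R).

Definition X_ (m : nat) (w : path_space S) : borel S := w m.

Lemma measurable_X_ m : measurable_fun setT (X_ m).
Proof.
by move=> _ B mB; apply: sub_sigma_algebra; exists m => //; exists B.
Qed.

HB.instance Definition _ m :=
  isMeasurableFun.Build _ _ (path_space S) (borel S) (X_ m) (measurable_X_ m).

(* Pr is the law P_x of the chain with kernel Q started at x: X_0 = x almost
   surely, and P_x(X_{m+1} \in B | X_0, ..., X_m) = Q(X_m, B), the conditional
   probability being spelled out by its defining identity on the events C of
   sigma(X_0, ..., X_m). Such a law exists for every probability kernel
   (Ionescu-Tulcea) and is unique on measurable sets. *)
Definition markov_law (Q : R.-pker (borel S) ~> (borel S)) (x : S)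
    (Pr : probability (path_space S) R) :=
  Pr [set w | X_ 0 w = x] = 1%E /\
  forall (m : nat) (C : set (path_space S)) (B : set (borel S)),
    g_sigma_preimage (fun i : 'I_m.+1 => X_ i) C -> measurable B ->
    Pr (C `&` X_ m.+1 @^-1` B) = (\int[Pr]_(w in C) Q (X_ m w) B)%E.

End markov_chain.
Arguments X_ {R S} m w.

(* Main.v *)
(* Write b(mu, nu) for the dual Lipschitz distance.  Integrals converging for
   each f in Lip_b(1) already converge uniformly in f: with u dense and
   g_k = min(1, min_{i < k} d(., u_i)), functions e-close at u_0, ..., u_{k-1}
   are within e + 2 g_k of each other, and the integral of g_k against the limit
   tends to 0.  Hence P_n^m(x, .) -> P_oo^m(x, .) in b for each m, by induction
   on m.  Since P_n is nonexpansive for b and fixes pi_n,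
   b(P_n^m(x, .), pi_n) is nonincreasing in m, so for m >= M
     b(P_n^m, P_oo^m) <= b(P_n^M, P_oo^M) + b(P_oo^M, pi_oo)
                         + 2 b(pi_oo, pi_n) + b(pi_oo, P_oo^m). *)
Require Import Defs.
From mathcomp Require Import all_boot all_order all_algebra.
From mathcomp Require Import all_classical all_reals all_analysis.
From mathcomp Require Import measurable_realfun lra.

Set Implicit Arguments.
Unset Strict Implicit.
Unset Printing Implicit Defensive.

Import Order.TTheory GRing.Theory Num.Theory.
Import numFieldNormedType.Exports.

Local Open Scope classical_set_scope.
Local Open Scope ring_scope.

(** * Integrals of functions bounded by one *)

Section bounded_integrals.
Context d (T : measurableType d) (R : realType).
Implicit Types (mu nu : probability T R) (f g : T -> R).

Lemma bounded_fun_le1 (U : Type) (f : U -> R) :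
  (forall x, `|f x| <= 1) -> bounded_fun f.
Proof.
move=> f1; exists 1; split => // M M1 x _.
exact: le_trans (f1 x) (ltW M1).
Qed.

Lemma integrable_le1 (mu : {measure set T -> \bar R}) f :
  mu setT = 1%E -> measurable_fun setT f -> (forall x, `|f x| <= 1) ->
  mu.-integrable setT (EFin \o f).
Proof.
move=> mu1 mf f1; apply: measurable_bounded_integrable => //.
  by rewrite mu1 ltry.
exact: bounded_fun_le1.
Qed.

(** Integrates the pointwise estimate of [Lip_b1_diff_le], where [h] is the truncated distance to
    finitely many points. *)
Lemma Rintegral_diff_le mu f g (h : T -> R) (e : R) :
  measurable_fun setT f -> (forall x, `|f x| <= 1) ->
  measurable_fun setT g -> (forall x, `|g x| <= 1) ->
  measurable_fun setT h -> (forall x, `|h x| <= 1) ->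
  (forall x, `|f x - g x| <= e + 2 * h x) ->
  `|\int[mu]_x f x - \int[mu]_x g x| <= e + 2 * \int[mu]_x h x.
Proof.
move=> mf f1 mg g1 mh h1 fgh.
have iE (k : T -> R) : measurable_fun setT k -> (forall x, `|k x| <= 1) ->
    mu.-integrable setT (EFin \o k).
  by move=> mk k1; apply: integrable_le1 => //; exact: probability_setT.
have i2h : mu.-integrable setT (EFin \o (fun x => 2 * h x)).
  by apply: (@integrableZl _ _ _ mu setT measurableT 2 _ (iE _ mh h1)).
have ie : mu.-integrable setT (EFin \o (cst e)).
  by apply: finite_measure_integrable_cst.
have ih : mu.-integrable setT (EFin \o (fun x => e + 2 * h x)).
  exact: (integrableD measurableT ie i2h).
have ifg : mu.-integrable setT (EFin \o (fun x => f x - g x)).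
  exact: (integrableB measurableT (iE _ mf f1) (iE _ mg g1)).
rewrite -RintegralB//; [|exact: iE..].
apply: le_trans (le_normr_Rintegral measurableT ifg) _.
apply: (@le_trans _ _ (\int[mu]_x (e + 2 * h x))).
  by apply: le_Rintegral => //; exact: integrable_norm.
rewrite (RintegralD measurableT ie i2h) Rintegral_cst//.
  rewrite [X in _ * fine X](_ : _ = 1%E); last exact: probability_setT.
  rewrite mulr1.
by rewrite RintegralZl//; exact: iE.
Qed.

Lemma dominated_convergence_le1 mu (f_ : nat -> T -> R) f :
  (forall n, measurable_fun setT (f_ n)) -> (forall n x, `|f_ n x| <= 1) ->
  measurable_fun setT f ->
  (forall x, f_ n x @[n --> \oo] --> f x) ->
  \int[mu]_x f_ n x @[n --> \oo] --> \int[mu]_x f x.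
Proof.
move=> mf_ f_1 mf f_f.
have ef_f x : (f_ n x)%:E @[n --> \oo] --> (f x)%:E.
  by apply: cvg_EFin (f_f x); exact: nearW.
have [_ _] := @dominated_convergence _ _ _ mu setT measurableT
  (fun n => EFin \o f_ n) (EFin \o f) (cst 1%E)
  (fun n => (measurable_EFinP _ _).2 (mf_ n)) ((measurable_EFinP _ _).2 mf)
  (aeW _ (fun x _ => ef_f x))
  (finite_measure_integrable_cst mu 1 measurableT)
  (aeW _ (fun x n _ => f_1 n x)).
have ff : (\int[mu]_x (f x)%:E)%E \is a fin_num.
  apply: integrable_fin_num => //.
  apply: integrable_le1 => //; first exact: probability_setT.
  (* The limit inherits the bound 1 pointwise from the sequence. *)
  move=> x; apply: (@cvgr_to_le _ \oo _ R (fun n => `|f_ n x|)).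
    exact: cvg_norm (f_f x).
  exact: nearW.
rewrite -(fineK ff) => /fine_cvgP[_]; exact.
Qed.

End bounded_integrals.

(** * Integration against the image of a measure under a kernel *)

Section kernel_integrals.
Context d (T : measurableType d) (R : realType).
Implicit Types (mu nu : probability T R) (Q : R.-pker T ~> T) (f : T -> R).

Lemma ge0_integral_bind mu nu Q (f : T -> \bar R) :
  (forall B, measurable B -> nu B = \int[mu]_y Q y B)%E ->
  (forall y, 0 <= f y)%E -> measurable_fun setT f ->
  (\int[nu]_y f y = \int[mu]_y \int[Q y]_z f z)%E.
Proof.
move=> nuE f0 mf.
(* Seen as a constant kernel, [mu] can be composed with [Q]; the composite, evaluated at an
   arbitrary point, agrees with [nu] on measurable sets. *)
have mmu : measurable_fun [set: T] (cst mu : T -> pprobability T R).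
  exact: measurable_cst.
pose x0 : T := point.
rewrite -(integral_kcomp (kprobability mmu) (kernel.kernel_snd Q) x0 f0 mf).
apply: eq_measure_integral => B mB _; exact: nuE.
Qed.

Lemma Rintegral_bind mu nu Q f :
  (forall B, measurable B -> nu B = \int[mu]_y Q y B)%E ->
  measurable_fun setT f -> (forall y, `|f y| <= 1) ->
  measurable_fun setT (fun y => \int[Q y]_z f z) ->
  (forall y, `|\int[Q y]_z f z| <= 1) ->
  \int[nu]_y f y = \int[mu]_y \int[Q y]_z f z.
Proof.
move=> nuE mf f1 mQf Qf1.
(* Adding 1 makes [f] nonnegative, so that [ge0_integral_bind] applies. Every measure involved has
   mass one, so each side grows by exactly 1, which cancels at the end. *)
have addE (m : {measure set T -> \bar R}) (g : T -> R) : m setT = 1%E ->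
    measurable_fun setT g -> (forall y, `|g y| <= 1) ->
    (\int[m]_y (g y + 1)%:E = (\int[m]_y g y + 1)%:E)%E.
  move=> m1 mg g1.
  have ig : m.-integrable setT (EFin \o g) by exact: integrable_le1.
  have i1 : m.-integrable setT (EFin \o cst 1).
    by apply: integrable_le1 => // y; rewrite normr1.
  have int1 : (\int[m]_y (EFin \o cst 1%R) y = 1)%E.
    by have := integral_cst m measurableT 1%E; rewrite m1 mule1.
  under eq_integral do rewrite EFinD.
  rewrite (integralD measurableT ig i1) int1 EFinD.
  by rewrite fineK//; exact: integrable_fin_num.
have := @ge0_integral_bind mu nu Q (fun y => (f y + 1)%:E) nuE.
rewrite addE//; last exact: probability_setT.
under [in X in _ -> _ -> _ = X]eq_integral do rewrite addE ?prob_kernel//.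
rewrite addE//; last exact: probability_setT.
move=> /(_ _ _)/wrap[].
- by move=> y; rewrite lee_fin; have := f1 y; rewrite ler_norml => /andP[]; lra.
- by apply/measurable_EFinP; exact: measurable_funD.
- by case=> /addIr.
Qed.

End kernel_integrals.

(** * Bounded Lipschitz functions and dense sequences *)

Section lipschitz_functions.
Context (R : realType) (S : pmetricType R).
Implicit Types f g : S -> R.

Lemma Lip_b_continuous r f : 0 < r -> Lip_b r f -> continuous f.
Proof.
move=> r0 [_ fr] x; apply/cvgrPdist_lt => e e0.
near=> y; apply: (le_lt_trans (fr x y)).
rewrite mulrC -ltr_pdivlMr//.
have : ball x (e / r) y by near: y; apply: nbhsx_ballx; exact: divr_gt0.
by rewrite ballEmdist.
Unshelve. all: by end_near. Qed.

Lemma continuous_borel_measurable f :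
  continuous f -> measurable_fun [set: borel S] f.
Proof.
move=> /continuousP cf; apply: (measurability _ (RGenOpens.measurableE R)).
move=> _ [_ [a [b ->] <-]]; rewrite setTI.
by apply: sub_sigma_algebra; exact/cf/interval_open.
Qed.

Lemma Lip_b1_measurable f : Lip_b 1 f -> measurable_fun [set: borel S] f.
Proof.
by move=> /(Lip_b_continuous ltr01); exact: continuous_borel_measurable.
Qed.

Lemma weak_cvg_Lip_b1 (mu_ : nat -> {measure set (borel S) -> \bar R}) mu f :
  weak_cvg mu_ mu -> Lip_b 1 f ->
  \int[mu_ n]_y f y @[n --> \oo] --> \int[mu]_y f y.
Proof.
move=> cmu Lf; apply: cmu; first exact: Lip_b_continuous Lf.
by apply: bounded_fun_le1; exact: Lf.1.
Qed.

Lemma Lip_b1_cst c : `|c| <= 1 -> Lip_b 1 (cst c : S -> R).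
Proof. by move=> c1; split=> // x y; rewrite subrr normr0 mul1r mdist_ge0. Qed.

Lemma Lip_b1_min f g : Lip_b 1 f -> Lip_b 1 g ->
  Lip_b 1 (fun x => Num.min (f x) (g x)).
Proof.
move=> [f1 fL] [g1 gL]; split=> [x|x y].
  by have [] := leP (f x) (g x).
have := fL x y; have := gL x y; rewrite !ler_norml => /andP[? ?] /andP[? ?].
by have [] := leP (f x) (g x); have [] := leP (f y) (g y) => ? ?; lra.
Qed.

Lemma Lip_b1_min1_mdist (u : S) : Lip_b 1 (fun y => Num.min 1 (mdist y u)).
Proof.
split=> [x|x y].
  have := mdist_ge0 x u; rewrite ler_norml.
  by have [] := leP 1 (mdist x u) => ? ?; lra.
have := metric_triangle x y u; have := metric_triangle y x u.
rewrite (metric_sym y x) ler_norml => ? ?; have := mdist_ge0 x y.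
by have [] := leP 1 (mdist x u); have [] := leP 1 (mdist y u) => ? ? ?; lra.
Qed.

Lemma separable_dense_sequence : separable S ->
  exists u : nat -> S, forall x e, 0 < e -> exists n, mdist x (u n) < e.
Proof.
move=> [D /countable_injP[f f_inj] Dd].
(* [u] inverts the injection of [D] into the integers; integers outside its image get the default
   [point], so a finite [D] is covered too. *)
have /choice[u uP] n : exists x, (exists2 y, D y & f y = n) -> D x /\ f x = n.
  have [[y Dy fy]|] := pselect (exists2 y, D y & f y = n); first by exists y.
  by exists point.
exists u => x e e0.
have [] := Dd (ball x e)°.
- by exists x; apply: nbhsx_ballx.
- exact: open_interior.
move=> y [/interior_subset xy Dy]; exists (f y).
have [Du fu] := uP (f y) (ex_intro2 _ _ _ Dy erefl).
by rewrite (f_inj (u (f y)) y) ?inE//; move: xy; rewrite ballEmdist.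
Qed.

End lipschitz_functions.

(** * From convergence for each function to uniform convergence over [Lip_b 1] *)

Section uniform_convergence.
Context (R : realType) (S : pmetricType R).
Implicit Types (f g : S -> R) (mu nu : probability (borel S) R).

(** The cap 1 is repeated at every step so that each term of the minimum is itself in [Lip_b 1]. *)
Fixpoint truncated_dist (u : nat -> S) (k : nat) (y : S) : R :=
  if k is j.+1 then
    Num.min (truncated_dist u j y) (Num.min 1 (mdist y (u j)))
  else 1.

Lemma Lip_b1_truncated_dist u k : Lip_b 1 (truncated_dist u k).
Proof.
elim: k => [|k IH] /=; first by apply: Lip_b1_cst; rewrite normr1.
by apply: Lip_b1_min => //; exact: Lip_b1_min1_mdist.
Qed.

Lemma truncated_dist_ge0 u k y : 0 <= truncated_dist u k y.
Proof. by elim: k => //= k IH; rewrite !le_min IH ler01 mdist_ge0. Qed.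

Lemma truncated_dist_le u k i y : (i < k)%N ->
  truncated_dist u k y <= mdist y (u i).
Proof.
elim: k => // k IH; rewrite ltnS leq_eqVlt => /predU1P[->|/IH ik] /=.
  by rewrite !ge_min lexx !orbT.
by rewrite ge_min ik.
Qed.

(** A detour through [u i] costs [mdist y (u i)] once for [f] and once for [g], and the cap 1 is
    covered by the trivial bound 2 on the difference. The minimum equals one of these terms, so the
    bounds for the separate terms suffice. *)
Lemma Lip_b1_diff_le u k f g e : 0 <= e -> Lip_b 1 f -> Lip_b 1 g ->
  (forall i, (i < k)%N -> `|f (u i) - g (u i)| <= e) ->
  forall y, `|f y - g y| <= e + 2 * truncated_dist u k y.
Proof.
move=> e0 [f1 fL] [g1 gL] + y.
have fg2 : `|f y - g y| <= e + 2 * 1.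
  by rewrite (le_trans (ler_normB _ _))//; have := f1 y; have := g1 y; lra.
elim: k => [|k IH] //= fge.
have {}IH := IH (fun i ik => fge i (ltnW ik)).
have fgk : `|f y - g y| <= e + 2 * mdist y (u k).
  have := fge k (ltnSn k); have := fL y (u k); have := gL y (u k).
  by rewrite !ler_norml => /andP[? ?] /andP[? ?] /andP[? ?]; lra.
by rewrite !minEle; case: ifP => // _; case: ifP.
Qed.

Lemma truncated_dist_cvg0 u :
  (forall x e, 0 < e -> exists n, mdist x (u n) < e) ->
  forall y, truncated_dist u k y @[k --> \oo] --> (0 : R).
Proof.
move=> ud y; apply/cvgrPdist_lt => e e0.
have [n yn] := ud y e e0; near=> k.
rewrite sub0r normrN ger0_norm ?truncated_dist_ge0//.
apply: le_lt_trans yn; apply: truncated_dist_le; near: k.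
exact: nbhs_infty_gt.
Unshelve. all: by end_near. Qed.

(* Arzela-Ascoli: on finitely many points, [Lip_b 1] is totally bounded. *)
Lemma Lip_b1_finite_net (u : nat -> S) (k : nat) (e : R) : 0 < e ->
  exists (I : finType) (h : I -> S -> R), (forall c, Lip_b 1 (h c)) /\
    forall f, Lip_b 1 f -> exists c,
      forall i, (i < k)%N -> `|f (u i) - h c (u i)| <= e.
Proof.
(* The interval [-1, 1] is cut into cells of length [e], numbered from its left end; since t + 1 is
   at most 2, the numbers run from 0 to [N]. *)
move=> e0; pose N := Num.truncn (2 / e).
pose cell (t : R) := Num.truncn ((t + 1) / e).
have cellN t : `|t| <= 1 -> (cell t < N.+1)%N.
  rewrite ler_norml => /andP[_ t1]; rewrite ltnS; apply: le_truncn.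
  by rewrite ler_pM2r ?invr_gt0//; lra.
have cellE s t : `|s| <= 1 -> `|t| <= 1 -> cell s = cell t -> `|s - t| <= e.
  rewrite !ler_norml => /andP[s1 _] /andP[t1 _] st.
  have /truncn_itv : 0 <= (s + 1) / e by rewrite divr_ge0 ?(ltW e0)//; lra.
  have /truncn_itv : 0 <= (t + 1) / e by rewrite divr_ge0 ?(ltW e0)//; lra.
  rewrite -/(cell s) -/(cell t) st ler_pdivlMr// ltr_pdivrMr//.
  rewrite ler_pdivlMr// ltr_pdivrMr// -natr1.
  set c := (cell t)%:R; rewrite mulrDl mul1r.
  by move=> /andP[? ?] /andP[? ?]; lra.
pose I : finType := {ffun 'I_k -> 'I_N.+1}.
pose key f : I := [ffun i : 'I_k => inord (cell (f (u i)))].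
(* Functions are sorted by their cells at the [k] points, and each class that occurs keeps one of
   its members as centre. A class that does not occur gets the zero function. *)
have /choice[h hP] (c : I) : exists g, Lip_b 1 g /\
    ((exists2 f, Lip_b 1 f & key f = c) -> key g = c).
  have [[f Lf fc]|] := pselect (exists2 f, Lip_b 1 f & key f = c).
    by exists f.
  by exists (cst 0); split => //; apply: Lip_b1_cst; rewrite normr0.
exists I, h; split=> [c|f Lf]; first exact: (hP c).1.
exists (key f) => i ik.
have [Lg] := hP (key f); move=> /(_ (ex_intro2 _ _ f Lf erefl)).
move=> /ffunP/(_ (Ordinal ik)); rewrite !ffunE /= => /(congr1 val) /=.
rewrite !inordK ?cellN//; [|exact: Lf.1|exact: Lg.1] => gf.
by apply: cellE => //; [exact: Lf.1|exact: Lg.1].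
Qed.

(** Bounds the dual distance by [e] without forming an extended real supremum. *)
Definition Lip_b1_close (e : R) mu nu :=
  forall f, Lip_b 1 f -> `|\int[mu]_y f y - \int[nu]_y f y| <= e.

Lemma Lip_b1_close_sym e mu nu : Lip_b1_close e mu nu -> Lip_b1_close e nu mu.
Proof. by move=> mn f Lf; rewrite distrC; exact: mn. Qed.

Lemma Lip_b1_close_trans nu e1 e2 mu1 mu2 :
  Lip_b1_close e1 mu1 nu -> Lip_b1_close e2 nu mu2 ->
  Lip_b1_close (e1 + e2) mu1 mu2.
Proof.
move=> h1 h2 f Lf; apply: le_trans (ler_distD (\int[nu]_y f y) _ _) _.
by apply: lerD; [exact: h1|exact: h2].
Qed.

Lemma Lip_b1_cvg_uniform (mu_ : nat -> probability (borel S) R) mu :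
  separable S ->
  (forall f, Lip_b 1 f -> \int[mu_ n]_y f y @[n --> \oo] --> \int[mu]_y f y) ->
  forall e, 0 < e -> \forall n \near \oo, Lip_b1_close e (mu_ n) mu.
Proof.
move=> /separable_dense_sequence[u ud] cmu e e0.
(* Replacing [f] by its centre costs d + 2d under [mu] and d + 2(2d) under [mu_ n]; comparing the
   two integrals of the centre costs d more. The total is 9d. *)
pose d := e / 9; have d0 : 0 < d by rewrite divr_gt0.
have Lm k := Lip_b1_measurable (Lip_b1_truncated_dist u k).
have [k gk] : exists k, \int[mu]_y truncated_dist u k y <= d.
  have : \int[mu]_y truncated_dist u k y @[k --> \oo] --> \int[mu]_y (0 : R).
    apply: dominated_convergence_le1 => //.
    - by move=> n x; exact: (Lip_b1_truncated_dist u n).1.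
    - exact: truncated_dist_cvg0.
  rewrite Rintegral_cst// mul0r => /cvgrPdist_le/(_ d d0)[k _ /(_ k (leqnn k))].
  by rewrite /= sub0r normrN => ?; exists k; exact: le_trans (ler_norm _) _.
have [I [h [hL hnet]]] := Lip_b1_finite_net u k d0.
have gn : \forall n \near \oo, \int[mu_ n]_y truncated_dist u k y <= d + d.
  have /cvgrPdist_le/(_ d d0) := cmu _ (Lip_b1_truncated_dist u k).
  by apply: filterS => n; rewrite ler_norml => /andP[]; lra.
(* The net is finite, so one threshold for n serves all centres. *)
have hn : \forall n \near \oo, forall c : I,
    `|\int[mu]_y h c y - \int[mu_ n]_y h c y| <= d.
  apply: filter_forall => c.
  by have /cvgrPdist_le/(_ d d0) := cmu _ (hL c).
near=> n => f Lf.
have gnn : \int[mu_ n]_y truncated_dist u k y <= d + d by near: n.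
have hnn : forall c, `|\int[mu]_y h c y - \int[mu_ n]_y h c y| <= d.
  by near: n.
have [c fc] := hnet f Lf.
have fh (m : probability (borel S) R) : `|\int[m]_y f y - \int[m]_y h c y| <=
    d + 2 * \int[m]_y truncated_dist u k y.
  apply: Rintegral_diff_le => //; try exact: Lip_b1_measurable.
  - exact: Lf.1.
  - exact: (hL c).1.
  - exact: (Lip_b1_truncated_dist u k).1.
  - by apply: Lip_b1_diff_le => //; exact: ltW.
have := fh mu; have := fh (mu_ n); have := hnn c.
have de : e = 9 * d by rewrite /d mulrC divfK.
rewrite de !ler_norml => /andP[? ?] /andP[? ?] /andP[? ?].
by apply/andP; split; lra.
Unshelve. all: by end_near. Qed.

End uniform_convergence.

(** * The integral against a difference of probabilities *)

Section jordan_integral.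
Context (R : realType) (S : pmetricType R).

(** If [jp] and [jn] are the Jordan parts of mu - nu, then mu + jn = nu + jp on measurable sets.
    Integrating this identity between positive measures and rearranging the finite terms gives the
    claim. *)
Lemma charge_integral_diff (mu nu : probability (borel S) R) f :
  Lip_b 1 f ->
  charge_integral (charge_diff mu nu) f = \int[mu]_y f y - \int[nu]_y f y.
Proof.
move=> Lf; rewrite /charge_integral.
set jp := jordan_pos _; set jn := jordan_neg _.
have subadd (a b c d : \bar R) : a \is a fin_num -> b \is a fin_num ->
    c \is a fin_num -> d \is a fin_num -> (a - b = c - d -> a + d = b + c)%E.
  move=> /fineK <- /fineK <- /fineK <- /fineK <-.
  by rewrite -!EFinB -!EFinD => -[?]; congr (_%:E); lra.
have jE A : measurable A -> (measure_add mu jn A = measure_add nu jp A)%E.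
  move=> mA; rewrite !measure_addE.
  apply: subadd; [exact: fin_num_measure..|].
  have := jordan_decomp (hahn_pos_neg (charge_diff mu nu)) mA.
  by rewrite /cadd/= /cscale/= !mulN1e.
have mf := Lip_b1_measurable Lf.
have iE (m : {finite_measure set (borel S) -> \bar R}) :
    m.-integrable setT (EFin \o f).
  apply: measurable_bounded_integrable => //.
    by rewrite ltey_eq fin_num_measure.
  by apply: bounded_fun_le1; exact: Lf.1.
have fin (m : {finite_measure set (borel S) -> \bar R}) :
    (\int[m]_y (f y)%:E)%E = (\int[m]_y f y)%:E.
  by rewrite fineK//; apply: integrable_fin_num => //; exact: iE.
have := @eq_measure_integral _ _ _ setT (measure_add nu jp) (measure_add mu jn)
  (EFin \o f) (fun A mA _ => jE A mA).
rewrite !integral_measure_add//; try exact: iE; try exact/measurable_EFinP.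
by rewrite /= !fin -!EFinD => -[?]; lra.
Qed.

End jordan_integral.

(** * One-dimensional laws of the Markov chain *)

Section chain_distributions.
Context (R : realType) (S : pmetricType R).
Variables (Q : R.-pker (borel S) ~> (borel S)) (x : S).
Variable Pr : probability (path_space S) R.
Hypothesis Pr_markov : markov_law Q x Pr.

(** The singleton of [x] is closed, hence Borel, and carries all the mass, so [f] is almost
    everywhere equal to [f x]. *)
Lemma distribution_X0 f : Lip_b 1 f ->
  \int[distribution Pr (X_ 0)]_y f y = f x.
Proof.
move=> Lf; have mf := Lip_b1_measurable Lf.
have mx : measurable ([set x] : set (borel S)).
  rewrite -[X in measurable X]setCK; apply: measurableC.
  apply: sub_sigma_algebra; apply: closed_openC.
  apply: accessible_closed_set1; apply: hausdorff_accessible.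
  exact: metric_hausdorff.
have -> : \int[distribution Pr (X_ 0)]_y f y =
          \int[distribution Pr (X_ 0)]_y f x.
  congr fine; apply: ae_eq_integral => //; first exact/measurable_EFinP.
  exists (~` [set x]); split => [|| y /= fy yx]; first exact: measurableC.
    rewrite [LHS](_ : _ = 1 - distribution Pr (X_ 0) [set x])%E.
      by rewrite [X in (1 - X)%E](Pr_markov.1) subee.
    exact: probability_setC.
  by apply: fy => _; rewrite yx.
rewrite Rintegral_cst// [X in _ * fine X](_ : _ = 1%E) ?mulr1//.
exact: probability_setT.
Qed.

(** The Markov identity with the whole path space as the past event, followed by a change of
    variables along [X_ m]. *)
Lemma distribution_XS m B : measurable B ->
  (distribution Pr (X_ m.+1) B = \int[distribution Pr (X_ m)]_y Q y B)%E.
Proof.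
move=> mB; rewrite ge0_integral_distribution//; last exact: measurable_kernel.
have := Pr_markov.2 m setT B; rewrite setTI; apply => //.
by rewrite -setC0 -setTD; apply: sigma_algebraCD; exact: sigma_algebra0.
Qed.

End chain_distributions.

(** * Convergence of the laws, first at a fixed time, then uniformly in time *)

Section kernel_convergence.
Context (R : realType) (S : pmetricType R).
Variables (P : nat -> R.-pker (borel S) ~> (borel S)).
Variables (Poo : R.-pker (borel S) ~> (borel S)).
(** [L n m] stands for the law at time m of the chain with kernel [P n], and [Loo m] for that of the
    limit chain. *)
Variables (L : nat -> nat -> probability (borel S) R).
Variables (Loo : nat -> probability (borel S) R).
Hypothesis Ssep : separable S.
Hypothesis P_incl : forall n, Lip_b1_inclusion (P n).
Hypothesis Poo_incl : Lip_b1_inclusion Poo.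
Hypothesis cvgP : forall x, weak_cvg (fun n => P n x) (Poo x).
Hypothesis L0 : forall n f, Lip_b 1 f ->
  \int[L n 0%N]_y f y = \int[Loo 0%N]_y f y.
Hypothesis LS : forall n m B, measurable B ->
  (L n m.+1 B = \int[L n m]_y P n y B)%E.
Hypothesis LooS : forall m B, measurable B ->
  (Loo m.+1 B = \int[Loo m]_y Poo y B)%E.

(** The inclusion property supplies both the measurability and the bound that [Rintegral_bind] asks
    of the inner integral. *)
Lemma Rintegral_bind_Lip_b1 (Q : R.-pker (borel S) ~> (borel S))
    (mu nu : probability (borel S) R) f :
  Lip_b1_inclusion Q ->
  (forall B, measurable B -> nu B = \int[mu]_y Q y B)%E -> Lip_b 1 f ->
  \int[nu]_y f y = \int[mu]_y \int[Q y]_z f z.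
Proof.
move=> Qincl nuE Lf; have LQf := Qincl _ Lf.
apply: (Rintegral_bind nuE); [exact: Lip_b1_measurable|exact: Lf.1| |].
- exact: Lip_b1_measurable LQf.
- exact: LQf.1.
Qed.

(** By [Lip_b1_cvg_uniform] the inductive step concerns a fixed f. The error splits into the
    integral of P_n f against L_n^m - L_oo^m and that of P_n f - P_oo f against L_oo^m. The first is
    small because the induction hypothesis is uniform over [Lip_b 1], which contains P_n f for every
    n; the second tends to 0 by dominated convergence. *)
Lemma chain_cvg m e : 0 < e ->
  \forall n \near \oo, Lip_b1_close e (L n m) (Loo m).
Proof.
elim: m e => [|m IH] e e0.
  by apply: nearW => n f Lf; rewrite L0// subrr normr0 ltW.
apply: Lip_b1_cvg_uniform => // f Lf {e e0}; apply/cvgrPdist_le => e e0.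
have e20 : 0 < e / 2 by rewrite divr_gt0.
have : \int[Loo m]_y \int[P n y]_z f z @[n --> \oo] -->
       \int[Loo m]_y \int[Poo y]_z f z.
  apply: dominated_convergence_le1.
  - by move=> n; apply: Lip_b1_measurable; exact: P_incl.
  - by move=> n x; exact: (P_incl n Lf).1.
  - by apply: Lip_b1_measurable; exact: Poo_incl.
  - by move=> x; exact: weak_cvg_Lip_b1.
move=> /cvgrPdist_le/(_ _ e20); apply: filterS2 (IH _ e20) => n close dct.
rewrite (Rintegral_bind_Lip_b1 (P_incl n) (LS n m) Lf).
rewrite (Rintegral_bind_Lip_b1 Poo_incl (LooS m) Lf).
rewrite (splitr e).
apply: le_trans (ler_distD (\int[Loo m]_y \int[P n y]_z f z) _ _) _.
by rewrite lerD// distrC; apply: close; exact: P_incl.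
Qed.

Variables (pi : nat -> probability (borel S) R).
Variables (pioo : probability (borel S) R).
Hypothesis pi_stat : forall n, stationary (P n) (pi n).
Hypothesis cvgL : weak_cvg Loo pioo.
Hypothesis cvgpi : weak_cvg pi pioo.

(* A kernel preserving [Lip_b 1] is nonexpansive for the dual norm. *)
Lemma chain_stationary_close n m j e :
  Lip_b1_close e (L n m) (pi n) -> Lip_b1_close e (L n (m + j)) (pi n).
Proof.
move=> close; elim: j => [|j IH]; first by rewrite addn0.
rewrite addnS => f Lf.
rewrite (Rintegral_bind_Lip_b1 (P_incl n) (LS n (m + j)) Lf).
rewrite (Rintegral_bind_Lip_b1 (P_incl n) (fun B mB => esym (pi_stat n mB)) Lf).
by apply: IH; exact: P_incl.
Qed.

Lemma chain_cvg_uniform e : 0 < e ->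
  \forall n \near \oo, forall m, Lip_b1_close e (L n m) (Loo m).
Proof.
(* For times from [M] on, the path is [L n m], [pi n], [pioo], [Loo m]. The first link costs 3d,
   inherited from time [M] through [Loo M] and [pioo]; the other two cost d each. *)
move=> e0; pose d := e / 5; have d0 : 0 < d by rewrite divr_gt0.
have [M _ LooM] : \forall m \near \oo, Lip_b1_close d (Loo m) pioo.
  by apply: Lip_b1_cvg_uniform => // f; exact: weak_cvg_Lip_b1.
have pin : \forall n \near \oo, Lip_b1_close d (pi n) pioo.
  by apply: Lip_b1_cvg_uniform => // f; exact: weak_cvg_Lip_b1.
have LM := chain_cvg M d0.
(* The finitely many times before [M] are settled by [chain_cvg] alone. *)
have Lfin : \forall n \near \oo, forall m : 'I_M,
    Lip_b1_close e (L n m) (Loo m).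
  by apply: filter_forall => m; exact: chain_cvg.
near=> n => m; have [mM|Mm] := ltnP m M.
  have Lnm : forall m : 'I_M, Lip_b1_close e (L n m) (Loo m) by near: n.
  exact: (Lnm (Ordinal mM)).
have pinn : Lip_b1_close d (pi n) pioo by near: n.
have LMn : Lip_b1_close d (L n M) (Loo M) by near: n.
have LMpi : Lip_b1_close (d + d + d) (L n M) (pi n).
  apply: Lip_b1_close_trans (Lip_b1_close_sym pinn).
  by apply: Lip_b1_close_trans LMn _; exact: LooM (leqnn M).
have -> : e = d + d + d + d + d by rewrite /d; lra.
apply: Lip_b1_close_trans (Lip_b1_close_sym (LooM m Mm)).
apply: Lip_b1_close_trans pinn.
by rewrite -(subnKC Mm); exact: chain_stationary_close.
Unshelve. all: by end_near. Qed.

End kernel_convergence.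

Theorem proposition2 (R : realType) (S : pmetricType R)
    (P : nat -> R.-pker (borel S) ~> (borel S))
    (Poo : R.-pker (borel S) ~> (borel S))
    (pi : nat -> probability (borel S) R)
    (pioo : probability (borel S) R)
    (Pr : nat -> S -> probability (path_space S) R)
    (Proo : S -> probability (path_space S) R)
    (Ssep : separable S)
    (PrP : forall n x, (1 <= n)%N -> markov_law (P n) x (Pr n x))
    (ProoP : forall x, markov_law Poo x (Proo x))
    (P_incl : forall n, (1 <= n)%N -> Lip_b1_inclusion (P n))
    (Poo_incl : Lip_b1_inclusion Poo)
    (P_stat : forall n, (1 <= n)%N -> unique_stationary (P n) (pi n))
    (Poo_stat : unique_stationary Poo pioo)
    (cvg_kernel : forall x : S, weak_cvg (fun n => P n x) (Poo x))
    (cvg_chain : forall x : S,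
      weak_cvg (fun m => distribution (Proo x) (X_ m)) pioo)
    (cvg_stat : weak_cvg pi pioo) :
  forall x : S,
    ereal_sup (range (fun m =>
      Lip_b1_norm (charge_diff (distribution (Pr n x) (X_ m))
                               (distribution (Proo x) (X_ m)))))
      @[n --> \oo] --> 0%E.
Proof.
move=> x.
(* The hypotheses on kernels and laws start at index 1, so everything is applied to the sequences
   shifted by one, which have the same limits. *)
have close e : 0 < e -> \forall n \near \oo, forall m,
    Lip_b1_close e (distribution (Pr n.+1 x) (X_ m))
                   (distribution (Proo x) (X_ m)).
  move=> e0.
  apply: (@chain_cvg_uniform _ _ (fun n => P n.+1) Poo
    (fun n m => distribution (Pr n.+1 x) (X_ m))
    (fun m => distribution (Proo x) (X_ m)) Ssep
    (fun n => P_incl n.+1 isT) Poo_incl _ _ _ _ (fun n => pi n.+1) pioo) => //.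
  - by move=> y f cf bf; have := cvg_kernel y f cf bf; rewrite -cvg_shiftS.
  - move=> n f Lf; rewrite (distribution_X0 (PrP n.+1 x isT) Lf).
    by rewrite (distribution_X0 (ProoP x) Lf).
  - by move=> n m B; exact: (distribution_XS (PrP n.+1 x isT)).
  - by move=> m B; exact: (distribution_XS (ProoP x)).
  - by move=> n; exact: (P_stat n.+1 isT).1.
  - exact: cvg_chain.
  - by move=> f cf bf; have := cvg_stat f cf bf; rewrite -cvg_shiftS.
set s := fun n : nat => ereal_sup (range (fun m => Lip_b1_norm (charge_diff
  (distribution (Pr n x) (X_ m)) (distribution (Proo x) (X_ m))))).
rewrite -(cvg_shiftS s).
(* Time 0 and the zero function already witness the value 0 under the suprema. *)
have s_ge0 n : (0 <= s n)%E.
  have L0 : Lip_b 1 (cst 0 : S -> R) by apply: Lip_b1_cst; rewrite normr0.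
  apply: le_trans; last by apply: ereal_sup_ubound; exists 0%N.
  apply: le_trans; last by apply: ereal_sup_ubound; exists (cst 0).
  by rewrite lee_fin.
have s_le e : 0 < e -> \forall n \near \oo, (s n.+1 <= e%:E)%E.
  move=> /close; apply: filterS => n ne.
  apply: ge_ereal_sup => _ [m _ <-]; apply: ge_ereal_sup => _ [f Lf <-].
  by rewrite charge_integral_diff// lee_fin; exact: ne.
have s_fin e n : (s n <= e%:E)%E -> s n \is a fin_num.
  by move=> se; rewrite (ge0_fin_numE (s_ge0 n)) (le_lt_trans se (ltry e)).
(* Convergence to 0 in the extended reals requires eventual finiteness, for which the bound at
   tolerance 1 is enough, and then convergence of the real values. *)
apply/fine_cvgP; split.
  by apply: filterS (s_le 1 ltr01) => n; exact: s_fin.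
apply/cvgr0Pnorm_le => e e0; apply: filterS (s_le e e0) => n sn.
rewrite /= ger0_norm; last exact/fine_ge0/s_ge0.
by rewrite -lee_fin (fineK (s_fin _ _ sn)).
Qed.
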